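(* Let $A$ be a unital ring, let $G$ be an abelian group and $S$ a submonoid of $G$ such that $G=S^{-1}S$. Let $\alpha:S\to\mathrm{Endr}(A)$ be an action of $S$ on $A$ by corner isomorphisms. Then there exist a unital ring $B$, an action $\widehat{\alpha}:G\to\mathrm{Aut}(B)$, and an idempotent $e$ in $B$ such that $\widehat{\alpha}_s(e)\le e$ for all $s\in S$ and $$S^{\mathrm{op}}*_\alpha A*_\alpha S\;\cong\; e(B*_{\widehat\alpha}G)e$$ as $G$-graded rings.
   Context: $\mathrm{Endr}(A)$ is the monoid (under composition) of not necessarily unital ring endomorphisms of $A$. $G=S^{-1}S$ means every element of $G$ has the form $s^{-1}t$ with $s,t\in S$. For idempotents, $f\le e$ means $ef=fe=f$. An action $\alpha$ of $S$ on $A$ by corner isomorphisms is a monoid homomorphism $\alpha:S\to\mathrm{Endr}(A)$, $s\mapsto\alpha_s$, such that each $\alpha_s$ is an isomorphism of $A$ onto the corner ring $p_sAp_s$, where $p_s:=\alpha_s(1)$. $R=S^{\mathrm{op}}*_\alpha A*_\alpha S$ is the unital ring equipped with a unital ring homomorphism $\phi:A\to R$ and monoid homomorphisms $s\mapsto s_-$ from $S^{\mathrm{op}}$ to $R$ (so $(su)_-=u_-s_-$, $1_-=1$) and $t\mapsto t_+$ from $S$ to $R$ (to the multiplicative monoid), universal with respect to: (1) $t_+\phi(a)=\phi(\alpha_t(a))t_+$; (2) $\phi(a)s_-=s_-\phi(\alpha_s(a))$; (3) $s_-s_+=1$; (4) $s_+s_-=\phi(p_s)$, for all $a\in A$, $s,t\in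 S$. It is $G$-graded with $g$-component $R_g=\bigcup_{s,t\in S,\ s^{-1}t=g}s_-\phi(A)t_+$. $B*_{\widehat\alpha} G$ is the skew group ring: formal finite sums $\sum_{g\in G}b_gg$ with $b_g\in B$ and multiplication $(bg)(ch)=(b\,\widehat\alpha_g(c))(gh)$; it is $G$-graded with $g$-component $Bg$, and $e(B*_{\widehat\alpha}G)e$ is $G$-graded with $g$-component $e(Bg)e$. *)

(* Defs.v *)
From HB Require Import structures.
From mathcomp Require Import all_boot all_algebra finmap.
From mathcomp.classical Require Import boolp.
From mathcomp.multinomials Require Import monalg.

Set Implicit Arguments.
Unset Strict Implicit.
Unset Printing Implicit Defensive.

Import GRing.Theory.
Local Open Scope ring_scope.

(* Unital rings are [pzRingType], so that the zero ring is allowed. *)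

(* -------------------------------------------------------------------- *)
Section Corner.
Variable R : pzRingType.

Definition idem_le (f e : R) : Prop := e * f = f /\ f * e = f.

(* The corner ring eRe, with unit e. As e is idempotent, eRe consists of the
   x such that exe = x; see [cornerP]. *)
Record corner (e : R) (idem_e : e * e = e) : Type :=
  Corner { corner_val : R; _ : e * corner_val * e == corner_val }.

Variables (e : R) (idem_e : e * e = e).
Local Notation eRe := (corner idem_e).

HB.instance Definition _ := [isSub for @corner_val e idem_e].
HB.instance Definition _ := [Choice of eRe by <:].

Lemma cornerE (x : eRe) : e * val x * e = val x.
Proof. by apply/eqP; case: x. Qed.

Lemma corner_mull (x : eRe) : e * val x = val x.
Proof. by rewrite -cornerE !mulrA idem_e. Qed.

Lemma corner_mulr (x : eRe) : val x * e = val x.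
Proof. by rewrite -cornerE -!mulrA idem_e. Qed.

Lemma cornerP (x : R) :
  (exists y, x = e * y * e) <-> (exists z : eRe, val z = x).
Proof.
split=> [[y ->]|[z <-]]; last by exists (val z); rewrite cornerE.
have h : e * (e * y * e) * e == e * y * e.
  by rewrite !mulrA idem_e -!mulrA idem_e.
by exists (Corner idem_e h).
Qed.

Fact corner0_subproof : e * 0 * e == 0 :> R.
Proof. by rewrite mulr0 mul0r. Qed.
Definition corner0 : eRe := Corner idem_e corner0_subproof.

Fact cornerN_subproof (x : eRe) : e * (- val x) * e == - val x.
Proof. by rewrite mulrN mulNr cornerE. Qed.
Definition cornerN x := Corner idem_e (cornerN_subproof x).

Fact cornerD_subproof (x y : eRe) :
  e * (val x + val y) * e == val x + val y.
Proof. by rewrite mulrDr mulrDl !cornerE. Qed.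
Definition cornerD x y := Corner idem_e (cornerD_subproof x y).

Fact corner1_subproof : e * e * e == e :> R.
Proof. by rewrite !idem_e. Qed.
Definition corner1 := Corner idem_e corner1_subproof.

Fact cornerM_subproof (x y : eRe) :
  e * (val x * val y) * e == val x * val y.
Proof. by rewrite mulrA corner_mull -mulrA corner_mulr. Qed.
Definition cornerM x y := Corner idem_e (cornerM_subproof x y).

Fact cornerDA : associative cornerD.
Proof. by move=> x y z; apply/val_inj; rewrite /= addrA. Qed.
Fact cornerDC : commutative cornerD.
Proof. by move=> x y; apply/val_inj; rewrite /= addrC. Qed.
Fact corner0D : left_id corner0 cornerD.
Proof. by move=> x; apply/val_inj; rewrite /= add0r. Qed.
Fact cornerND : left_inverse corner0 cornerN cornerD.
Proof. by move=> x; apply/val_inj; rewrite /= addNr. Qed.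

HB.instance Definition _ :=
  GRing.isZmodule.Build eRe cornerDA cornerDC corner0D cornerND.

Fact cornerMA : associative cornerM.
Proof. by move=> x y z; apply/val_inj; rewrite /= mulrA. Qed.
Fact corner1M : left_id corner1 cornerM.
Proof. by move=> x; apply/val_inj; rewrite /= corner_mull. Qed.
Fact cornerM1 : right_id corner1 cornerM.
Proof. by move=> x; apply/val_inj; rewrite /= corner_mulr. Qed.
Fact cornerMDl : left_distributive cornerM cornerD.
Proof. by move=> x y z; apply/val_inj; rewrite /= mulrDl. Qed.
Fact cornerMDr : right_distributive cornerM cornerD.
Proof. by move=> x y z; apply/val_inj; rewrite /= mulrDr. Qed.

HB.instance Definition _ := GRing.Zmodule_isPzRing.Build eRe
  cornerMA corner1M cornerM1 cornerMDl cornerMDr.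

Lemma val_corner1 : val (1 : eRe) = e. Proof. by []. Qed.
Lemma val_cornerD (x y : eRe) : val (x + y) = val x + val y.
Proof. by []. Qed.
Lemma val_cornerM (x y : eRe) : val (x * y) = val x * val y.
Proof. by []. Qed.

End Corner.

(* -------------------------------------------------------------------- *)
(* An action of the monoid S on A by corner isomorphisms. The maps are
   additive and multiplicative but need not preserve 1; [cact_im] says that
   the image of the s-th one is pAp, where p is the image of 1. *)
Record corner_action (S : monoidType) (A : pzRingType) := CornerAction {
  cact :> S -> {additive A -> A};
  cact_mul : forall s a b, cact s (a * b) = cact s a * cact s b;
  cact_1 : forall a, cact 1%g a = a;
  cact_M : forall s t a, cact (s * t)%g a = cact s (cact t a);
  cact_inj : forall s, injective (cact s);
  cact_im : forall s b,
    (exists a, b = cact s a) <-> (exists c, b = cact s 1 * c * cact s 1)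
}.

(* -------------------------------------------------------------------- *)
(* The ring S^op *_alpha A *_alpha S, defined by its universal property. In
   the names below, [sm s] is s_- and [sp t] is t_+. *)
Section FractionalSkewMonoidRing.
Variables (S : monoidType) (A : pzRingType) (alpha : corner_action S A).

Record skew_rep (R : pzRingType) (phi : {rmorphism A -> R}) (sm sp : S -> R)
    : Prop := SkewRep {
  sm_1 : sm 1%g = 1;
  sm_M : forall s u, sm (s * u)%g = sm u * sm s;
  sp_1 : sp 1%g = 1;
  sp_M : forall t u, sp (t * u)%g = sp t * sp u;
  sp_phi : forall t a, sp t * phi a = phi (alpha t a) * sp t;
  phi_sm : forall s a, phi a * sm s = sm s * phi (alpha s a);
  sm_sp : forall s, sm s * sp s = 1;
  sp_sm : forall s, sp s * sm s = phi (alpha s 1)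
}.

Definition is_fractional_skew_monoid_ring
    (R : pzRingType) (phi : {rmorphism A -> R}) (sm sp : S -> R) : Prop :=
  skew_rep phi sm sp /\
  forall (T : pzRingType) (psi : {rmorphism A -> T}) (tm tp : S -> T),
    skew_rep psi tm tp ->
    let compat (h : {rmorphism R -> T}) :=
      [/\ forall a, h (phi a) = psi a,
          forall s, h (sm s) = tm s
        & forall t, h (sp t) = tp t] in
    exists2 h : {rmorphism R -> T}, compat h &
      forall h' : {rmorphism R -> T}, compat h' -> h' =1 h.

End FractionalSkewMonoidRing.

(* Existence of the ring above: terms in the generators, modulo the smallest
   ring congruence containing the relations. *)
Section Existence.
Variables (S : monoidType) (A : pzRingType) (alpha : corner_action S A).

Inductive term : Type :=
| Tphi of A | Tm of S | Tp of S | T0 | T1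
| TN of term | TD of term & term | TM of term & term.

Inductive cong : term -> term -> Prop :=
| cong_refl x : cong x x
| cong_sym x y : cong x y -> cong y x
| cong_trans x y z : cong x y -> cong y z -> cong x z
| congN x x' : cong x x' -> cong (TN x) (TN x')
| congD x x' y y' : cong x x' -> cong y y' -> cong (TD x y) (TD x' y')
| congM x x' y y' : cong x x' -> cong y y' -> cong (TM x y) (TM x' y')
| cong_addA x y z : cong (TD x (TD y z)) (TD (TD x y) z)
| cong_addC x y : cong (TD x y) (TD y x)
| cong_add0 x : cong (TD T0 x) x
| cong_addN x : cong (TD (TN x) x) T0
| cong_mulA x y z : cong (TM x (TM y z)) (TM (TM x y) z)
| cong_mul1l x : cong (TM T1 x) x
| cong_mul1r x : cong (TM x T1) x
| cong_mulDl x y z : cong (TM (TD x y) z) (TD (TM x z) (TM y z))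
| cong_mulDr x y z : cong (TM x (TD y z)) (TD (TM x y) (TM x z))
| cong_phi1 : cong (Tphi 1) T1
| cong_phiB a b : cong (Tphi (a - b)) (TD (Tphi a) (TN (Tphi b)))
| cong_phiM a b : cong (Tphi (a * b)) (TM (Tphi a) (Tphi b))
| cong_m1 : cong (Tm 1%g) T1
| cong_mM s u : cong (Tm (s * u)%g) (TM (Tm u) (Tm s))
| cong_p1 : cong (Tp 1%g) T1
| cong_pM s u : cong (Tp (s * u)%g) (TM (Tp s) (Tp u))
| cong_pphi t a : cong (TM (Tp t) (Tphi a)) (TM (Tphi (alpha t a)) (Tp t))
| cong_phim s a : cong (TM (Tphi a) (Tm s)) (TM (Tm s) (Tphi (alpha s a)))
| cong_mp s : cong (TM (Tm s) (Tp s)) T1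
| cong_pm s : cong (TM (Tp s) (Tm s)) (Tphi (alpha s 1)).

HB.instance Definition _ := gen_eqMixin term.
HB.instance Definition _ := gen_choiceMixin term.

Definition congb : rel term := fun x y => `[< cong x y >].

Fact congb_refl : reflexive congb.
Proof. by move=> x; apply/asboolP/cong_refl. Qed.
Fact congb_sym : symmetric congb.
Proof. by move=> x y; apply/asboolP/asboolP; apply: cong_sym. Qed.
Fact congb_trans : transitive congb.
Proof.
by move=> y x z /asboolP xy /asboolP yz; apply/asboolP/(cong_trans xy yz).
Qed.

Canonical congb_equiv := EquivRel congb congb_refl congb_sym congb_trans.

Definition fsmr := {eq_quot congb}%qT.
HB.instance Definition _ := Choice.on fsmr.
HB.instance Definition _ := EqQuotient.on fsmr.

Let cls (x : term) : fsmr := (\pi_fsmr x)%qT.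

Lemma clsP x y : cong x y -> cls x = cls y.
Proof. by move=> h; apply/eqquotP/asboolP. Qed.

Lemma clsK (x : fsmr) : cls (repr x) = x.
Proof. exact: reprK. Qed.

Lemma cong_repr x : cong (repr (cls x)) x.
Proof. by have /eqquotP/asboolP := clsK (cls x). Qed.

Definition fsmrN (x : fsmr) := cls (TN (repr x)).
Definition fsmrD (x y : fsmr) := cls (TD (repr x) (repr y)).
Definition fsmrM (x y : fsmr) := cls (TM (repr x) (repr y)).

Lemma fsmrNE x : fsmrN (cls x) = cls (TN x).
Proof. exact/clsP/congN/cong_repr. Qed.
Lemma fsmrDE x y : fsmrD (cls x) (cls y) = cls (TD x y).
Proof. by apply/clsP/congD; apply: cong_repr. Qed.
Lemma fsmrME x y : fsmrM (cls x) (cls y) = cls (TM x y).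
Proof. by apply/clsP/congM; apply: cong_repr. Qed.

Let fsmrE := (fsmrNE, fsmrDE, fsmrME).

Lemma fsmr_ind (Q : fsmr -> Prop) : (forall x, Q (cls x)) -> forall x, Q x.
Proof. by move=> h x; rewrite -[x]clsK. Qed.

Fact fsmrDA : associative fsmrD.
Proof.
elim/fsmr_ind=> x; elim/fsmr_ind=> y; elim/fsmr_ind=> z.
by rewrite !fsmrE; apply/clsP/cong_addA.
Qed.
Fact fsmrDC : commutative fsmrD.
Proof.
elim/fsmr_ind=> x; elim/fsmr_ind=> y; by rewrite !fsmrE; apply/clsP/cong_addC.
Qed.
Fact fsmr0D : left_id (cls T0) fsmrD.
Proof. by elim/fsmr_ind=> x; rewrite !fsmrE; apply/clsP/cong_add0. Qed.
Fact fsmrND : left_inverse (cls T0) fsmrN fsmrD.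
Proof. by elim/fsmr_ind=> x; rewrite !fsmrE; apply/clsP/cong_addN. Qed.

HB.instance Definition _ :=
  GRing.isZmodule.Build fsmr fsmrDA fsmrDC fsmr0D fsmrND.

Fact fsmrMA : associative fsmrM.
Proof.
elim/fsmr_ind=> x; elim/fsmr_ind=> y; elim/fsmr_ind=> z.
by rewrite !fsmrE; apply/clsP/cong_mulA.
Qed.
Fact fsmr1M : left_id (cls T1) fsmrM.
Proof. by elim/fsmr_ind=> x; rewrite !fsmrE; apply/clsP/cong_mul1l. Qed.
Fact fsmrM1 : right_id (cls T1) fsmrM.
Proof. by elim/fsmr_ind=> x; rewrite !fsmrE; apply/clsP/cong_mul1r. Qed.
Fact fsmrMDl : left_distributive fsmrM fsmrD.
Proof.
elim/fsmr_ind=> x; elim/fsmr_ind=> y; elim/fsmr_ind=> z.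
by rewrite !fsmrE; apply/clsP/cong_mulDl.
Qed.
Fact fsmrMDr : right_distributive fsmrM fsmrD.
Proof.
elim/fsmr_ind=> x; elim/fsmr_ind=> y; elim/fsmr_ind=> z.
by rewrite !fsmrE; apply/clsP/cong_mulDr.
Qed.

HB.instance Definition _ := GRing.Zmodule_isPzRing.Build fsmr
  fsmrMA fsmr1M fsmrM1 fsmrMDl fsmrMDr.

Definition fsmr_phi (a : A) : fsmr := cls (Tphi a).

Fact fsmr_phi_additive : zmod_morphism fsmr_phi.
Proof.
move=> a b; rewrite /fsmr_phi (clsP (cong_phiB a b)) -fsmrDE -fsmrNE.
by [].
Qed.
Fact fsmr_phi_multiplicative : monoid_morphism fsmr_phi.
Proof.
split=> [|a b]; first exact/clsP/cong_phi1.
by rewrite /fsmr_phi (clsP (cong_phiM a b)) -fsmrME.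
Qed.

HB.instance Definition _ :=
  GRing.isZmodMorphism.Build A fsmr fsmr_phi fsmr_phi_additive.
HB.instance Definition _ :=
  GRing.isMonoidMorphism.Build A fsmr fsmr_phi fsmr_phi_multiplicative.

Definition fsmr_m (s : S) : fsmr := cls (Tm s).
Definition fsmr_p (s : S) : fsmr := cls (Tp s).

Lemma fsmr_rep : skew_rep alpha fsmr_phi fsmr_m fsmr_p.
Proof.
split=> *; rewrite ?/GRing.mul /= ?fsmrE; apply/clsP; by constructor.
Qed.

Section Lift.
Variables (T : pzRingType) (psi : {rmorphism A -> T}) (tm tp : S -> T).
Hypothesis rep : skew_rep alpha psi tm tp.

Fixpoint teval (x : term) : T :=
  match x with
  | Tphi a => psi a | Tm s => tm s | Tp s => tp s | T0 => 0 | T1 => 1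
  | TN x => - teval x | TD x y => teval x + teval y
  | TM x y => teval x * teval y
  end.

Lemma teval_cong x y : cong x y -> teval x = teval y.
Proof.
case: rep => ? ? ? ? ? ? ? ?.
elim=> //=; first by move=> ? ? ? _ -> _ ->.
- by move=> ? ? _ ->.
- by move=> ? ? ? ? _ -> _ ->.
- by move=> ? ? ? ? _ -> _ ->.
- by move=> *; rewrite addrA.
- by move=> *; rewrite addrC.
- by move=> *; rewrite add0r.
- by move=> *; rewrite addNr.
- by move=> *; rewrite mulrA.
- by move=> *; rewrite mul1r.
- by move=> *; rewrite mulr1.
- by move=> *; rewrite mulrDl.
- by move=> *; rewrite mulrDr.
- exact: rmorph1.
- by move=> *; rewrite rmorphB.
- by move=> *; rewrite rmorphM.
Qed.

Definition lift_of (_ : skew_rep alpha psi tm tp) (x : fsmr) : T :=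
  teval (repr x).
Local Notation fsmr_lift := (lift_of rep).

Lemma fsmr_liftE x : fsmr_lift (cls x) = teval x.
Proof. exact/teval_cong/cong_repr. Qed.

Fact fsmr_lift_additive : zmod_morphism fsmr_lift.
Proof.
elim/fsmr_ind=> x; elim/fsmr_ind=> y.
by rewrite /GRing.opp /= /GRing.add /= !fsmrE !fsmr_liftE.
Qed.
Fact fsmr_lift_multiplicative : monoid_morphism fsmr_lift.
Proof.
split; first exact: (fsmr_liftE T1).
elim/fsmr_ind=> x; elim/fsmr_ind=> y.
by rewrite [LHS](congr1 fsmr_lift (fsmrME x y)) !fsmr_liftE.
Qed.

HB.instance Definition _ :=
  GRing.isZmodMorphism.Build fsmr T fsmr_lift fsmr_lift_additive.
HB.instance Definition _ :=
  GRing.isMonoidMorphism.Build fsmr T fsmr_lift fsmr_lift_multiplicative.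

Lemma fsmr_lift_unique (h : {rmorphism fsmr -> T}) :
  (forall a, h (fsmr_phi a) = psi a) -> (forall s, h (fsmr_m s) = tm s) ->
  (forall s, h (fsmr_p s) = tp s) -> h =1 fsmr_lift.
Proof.
move=> hphi hm hp; elim/fsmr_ind=> x; rewrite fsmr_liftE.
elim: x => //= [||x IHx|x IHx y IHy|x IHx y IHy].
- exact: (rmorph0 h).
- exact: (rmorph1 h).
- by rewrite -IHx -fsmrNE; apply: (rmorphN h).
- by rewrite -IHx -IHy -fsmrDE; apply: (rmorphD h).
- by rewrite -IHx -IHy -fsmrME; apply: (rmorphM h).
Qed.

End Lift.

Theorem fractional_skew_monoid_ring_exists :
  exists (R : pzRingType) (phi : {rmorphism A -> R}) (sm sp : S -> R),
    is_fractional_skew_monoid_ring alpha phi sm sp.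
Proof.
exists fsmr, fsmr_phi, fsmr_m, fsmr_p; split; first exact: fsmr_rep.
move=> T psi tm tp rep; exists (lift_of rep : {rmorphism fsmr -> T}).
  by split=> ?; rewrite /= fsmr_liftE.
by move=> h [hphi hm hp]; apply: fsmr_lift_unique.
Qed.

End Existence.

(* -------------------------------------------------------------------- *)
(* Actions of the group G on B by unital ring endomorphisms; these are
   automatically automorphisms, see [gact_bij]. *)
Record group_action (G : groupType) (B : pzRingType) := GroupAction {
  gact :> G -> {rmorphism B -> B};
  gact_1 : forall b, gact 1%g b = b;
  gact_M : forall g h b, gact (g * h)%g b = gact g (gact h b)
}.

Lemma gact_bij (G : groupType) (B : pzRingType) (ahat : group_action G B) g :
  bijective (ahat g).
Proof.
by exists (ahat g^-1%g) => b; rewrite -gact_M ?mulVg ?mulgV gact_1.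
Qed.

(* The skew group ring B *_ahat G. Its elements are the finitely supported
   functions from G to B, and << b *g g >> is the monomial bg. *)
Section SkewGroupRing.
Variables (G : groupType) (B : pzRingType).

Definition skew_group_ring (ahat : group_action G B) : Type := {malg B[G]}.

Variable ahat : group_action G B.
Local Notation SR := (skew_group_ring ahat).

HB.instance Definition _ := GRing.Zmodule.on SR.

Definition skew_monom (b : B) (g : G) : SR := << b *g g >>.

Definition skew_one : SR := skew_monom 1 1%g.

Definition skew_mul (x y : SR) : SR :=
  \sum_(g <- msupp x) \sum_(h <- msupp y)
    skew_monom (x@_g * ahat g y@_h) (g * h)%g.

Lemma skew_monom0 g : skew_monom 0 g = 0.
Proof. exact: monalgU0. Qed.

Lemma skew_monomD b c g : skew_monom (b + c) g = skew_monom b g + skew_monom c g.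
Proof. exact: monalgUD. Qed.

Lemma skew_mulw (d1 d2 : {fset G}) (x y : SR) :
  (msupp x `<=` d1)%fset -> (msupp y `<=` d2)%fset ->
  skew_mul x y = \sum_(g <- d1) \sum_(h <- d2)
    skew_monom (x@_g * ahat g y@_h) (g * h)%g.
Proof.
move=> le1 le2; rewrite /skew_mul (big_fset_incl _ le1) /=.
  apply/eq_bigr=> g _; apply/big_fset_incl => // h _ /mcoeff_outdom ->.
  by rewrite rmorph0 mulr0 skew_monom0.
move=> g _ /mcoeff_outdom x0.
by rewrite big1 // => h _; rewrite x0 mul0r skew_monom0.
Qed.

Lemma skew_mulUU b c g h :
  skew_mul (skew_monom b g) (skew_monom c h)
    = skew_monom (b * ahat g c) (g * h)%g.
Proof. by rewrite (skew_mulw msuppU_le msuppU_le) !big_seq_fset1 !mcoeffUU. Qed.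

Fact skew_mulDl : left_distributive skew_mul +%R.
Proof.
move=> x y z.
rewrite (skew_mulw (msuppD_le x y) (fsubset_refl (msupp z))).
rewrite (skew_mulw (fsubsetUl (msupp x) (msupp y)) (fsubset_refl (msupp z))).
rewrite (skew_mulw (fsubsetUr (msupp x) (msupp y)) (fsubset_refl (msupp z))).
rewrite -big_split /=; apply/eq_bigr=> g _.
rewrite -big_split /=; apply/eq_bigr=> h _.
by rewrite mcoeffD mulrDl skew_monomD.
Qed.

Fact skew_mulDr : right_distributive skew_mul +%R.
Proof.
move=> z x y.
rewrite (skew_mulw (fsubset_refl (msupp z)) (msuppD_le x y)).
rewrite (skew_mulw (fsubset_refl (msupp z)) (fsubsetUl (msupp x) (msupp y))).
rewrite (skew_mulw (fsubset_refl (msupp z)) (fsubsetUr (msupp x) (msupp y))).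
rewrite -big_split /=; apply/eq_bigr=> g _.
rewrite -big_split /=; apply/eq_bigr=> h _.
by rewrite mcoeffD rmorphD mulrDr skew_monomD.
Qed.

Fact skew_mul0l : left_zero 0 skew_mul.
Proof. by move=> x; rewrite /skew_mul msupp0 big_seq_fset0. Qed.

Fact skew_mul0r : right_zero 0 skew_mul.
Proof.
by move=> x; rewrite /skew_mul msupp0 big1 // => g _; rewrite big_seq_fset0.
Qed.

Lemma skew_ind (Q : SR -> Prop) :
  Q 0 -> (forall x y, Q x -> Q y -> Q (x + y)) ->
  (forall b g, Q (skew_monom b g)) -> forall x, Q x.
Proof.
move=> Q0 QD QU x; rewrite [x]monalgE.
by apply: (big_ind Q) => // g _; apply: QU.
Qed.

Fact skew_mulA : associative skew_mul.
Proof.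
move=> x y z; elim/skew_ind: x => [|x x' IH IH'|b g].
- by rewrite !skew_mul0l.
- by rewrite !skew_mulDl IH IH'.
elim/skew_ind: y => [|y y' IH IH'|c h].
- by rewrite !(skew_mul0l, skew_mul0r).
- by rewrite !(skew_mulDl, skew_mulDr) IH IH'.
elim/skew_ind: z => [|z z' IH IH'|d k].
- by rewrite !skew_mul0r.
- by rewrite !skew_mulDr IH IH'.
by rewrite !skew_mulUU rmorphM gact_M !mulrA mulgA.
Qed.

Fact skew_mul1l : left_id skew_one skew_mul.
Proof.
elim/skew_ind=> [|x y IH IH'|b g]; first exact: skew_mul0r.
  by rewrite skew_mulDr IH IH'.
by rewrite skew_mulUU gact_1 mul1r mul1g.
Qed.

Fact skew_mul1r : right_id skew_one skew_mul.
Proof.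
elim/skew_ind=> [|x y IH IH'|b g]; first exact: skew_mul0l.
  by rewrite skew_mulDl IH IH'.
by rewrite skew_mulUU rmorph1 mulr1 mulg1.
Qed.

HB.instance Definition _ := GRing.Zmodule_isPzRing.Build SR
  skew_mulA skew_mul1l skew_mul1r skew_mulDl skew_mulDr.

Lemma skew_monomM b c g h :
  skew_monom b g * skew_monom c h = skew_monom (b * ahat g c) (g * h)%g.
Proof. exact: skew_mulUU. Qed.

(* The embedding of B in B *_ahat G. *)
Definition skew_const (b : B) : SR := skew_monom b 1%g.

Lemma skew_const_idem (e : B) :
  e * e = e -> skew_const e * skew_const e = skew_const e.
Proof. by move=> ee; rewrite skew_monomM gact_1 ee mulg1. Qed.

End SkewGroupRing.

(* -------------------------------------------------------------------- *)
(* Here the submonoid S of G is given by a predicate P on G, and [val] is the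
   inclusion of S into G. *)
Definition fsmr_component (G : groupType) (P : {pred G}) (S : subMonoidType P)
    (A R : pzRingType) (phi : A -> R) (sm sp : S -> R) (g : G) (x : R) : Prop :=
  exists (s t : S) (a : A),
    ((val s)^-1 * val t)%g = g /\ x = sm s * phi a * sp t.

Definition corner_skew_component (G : groupType) (B : pzRingType)
    (ahat : group_action G B) (e : B) (idem_e : e * e = e) (g : G)
    (x : corner (skew_const_idem ahat idem_e)) : Prop :=
  exists b : B,
    val x = skew_const ahat e * skew_monom ahat b g * skew_const ahat e.

Definition graded_isomorphic (G : Type) (R R' : pzRingType)
    (Rg : G -> R -> Prop) (Rg' : G -> R' -> Prop) : Prop :=
  exists f : {rmorphism R -> R'},
    bijective f /\ forall g x, Rg g x <-> Rg' g (f x).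

(* Main.v *)
(* The injective maps alpha_s extend to injective unital endomorphisms of the
   unitization of A. As S is commutative, the direct limit B of the unitization
   along S exists, consists of fractions s^-1.c, and carries an action of G. Let
   e be the image of 1_A in B; then s.e is the image of p_s = alpha_s(1). In
   e(B * G)e the elements a, e s^-1 e and e t e satisfy the relations defining
   R, and the resulting map from R sends s_- phi(a) t_+ to e (s^-1.a) g e, where
   g = s^-1 t. Clearing denominators, every e(bg)e has this form, which gives
   surjectivity in each degree. For injectivity, R is spanned by the
   s_- phi(a) t_+, and sending e (s^-1.a) g e back to s_- phi(a) t_+ is a
   well-defined additive map. *)
From HB Require Import structures.
Require Import Defs.
From mathcomp Require Import all_boot all_algebra.
From mathcomp Require Import finmap.
From mathcomp.multinomials Require Import monalg.

Set Implicit Arguments.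
Unset Strict Implicit.
Unset Printing Implicit Defensive.
Local Open Scope ring_scope.

Import GRing.Theory.

(** * Direct limit of a ring along commuting injective endomorphisms *)

Record unital_action (S : monoidType) (C : pzRingType) := UnitalAction {
  uact :> S -> {rmorphism C -> C};
  uact_1 : forall c, uact 1%g c = c;
  uact_M : forall s t c, uact (s * t)%g c = uact s (uact t c);
  uact_inj : forall s, injective (uact s)
}.

Section DirectLimit.
Variables (S : monoidType) (C : pzRingType) (sigma : unital_action S C).
Hypothesis mulSC : forall s t : S, (s * t)%g = (t * s)%g.

Lemma uactC s t c : sigma s (sigma t c) = sigma t (sigma s c).
Proof. by rewrite -!uact_M mulSC. Qed.

(* The pair (s, c) stands for the element s^-1.c. *)
Definition frac_eq : rel (S * C) := fun x y => sigma y.1 x.2 == sigma x.1 y.2.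

Fact frac_eq_refl : reflexive frac_eq.
Proof. by move=> x; rewrite /frac_eq. Qed.
Fact frac_eq_sym : symmetric frac_eq.
Proof. by move=> x y; rewrite /frac_eq eq_sym. Qed.
Fact frac_eq_trans : transitive frac_eq.
Proof.
move=> [t d] [s c] [u k] /eqP /= cd /eqP /= dk.
(* Injectivity of [sigma t] cancels the middle denominator [t]. *)
by apply/eqP/(@uact_inj _ _ sigma t) => /=; rewrite uactC cd uactC dk uactC.
Qed.

Canonical frac_equiv := EquivRel frac_eq frac_eq_refl frac_eq_sym frac_eq_trans.

Definition dlim := {eq_quot frac_eq}%qT.
HB.instance Definition _ := Choice.on dlim.
HB.instance Definition _ := EqQuotient.on dlim.

Definition frac (s : S) (c : C) : dlim := (\pi_dlim (s, c))%qT.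

Lemma frac_eqP s c t d : frac s c = frac t d <-> sigma t c = sigma s d.
Proof.
by split=> [/eqquotP/eqP //|eq_cd]; apply/eqquotP; rewrite /= /frac_eq eq_cd.
Qed.

Lemma frac_repr x : frac (repr x).1 (repr x).2 = x.
Proof. by rewrite /frac -surjective_pairing reprK. Qed.

Lemma repr_frac s c :
  sigma s (repr (frac s c)).2 = sigma (repr (frac s c)).1 c.
Proof. by apply/frac_eqP; rewrite frac_repr. Qed.

Lemma fracP (x : dlim) : exists s c, x = frac s c.
Proof. by exists (repr x).1, (repr x).2; rewrite frac_repr. Qed.

Lemma frac_scale t s c : frac (t * s)%g (sigma t c) = frac s c.
Proof. by apply/frac_eqP; rewrite uactC uact_M. Qed.

Lemma frac_common (x y : dlim) : exists s c d, x = frac s c /\ y = frac s d.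
Proof.
have [s [c ->]] := fracP x; have [t [d ->]] := fracP y.
exists (t * s)%g, (sigma t c), (sigma s d).
by rewrite frac_scale mulSC frac_scale.
Qed.

Lemma frac_common3 (x y z : dlim) :
  exists s c d k, [/\ x = frac s c, y = frac s d & z = frac s k].
Proof.
have [s [c [d [-> ->]]]] := frac_common x y; have [t [k ->]] := fracP z.
exists (t * s)%g, (sigma t c), (sigma t d), (sigma s k).
by rewrite !frac_scale mulSC frac_scale.
Qed.

Definition frac_op (op : C -> C -> C) (x y : dlim) : dlim :=
  frac ((repr y).1 * (repr x).1)%g
    (op (sigma (repr y).1 (repr x).2) (sigma (repr x).1 (repr y).2)).

(** The representatives picked in [frac_op] do not matter because [op] commutes with the action;
    with [frac_common], the ring axioms of the limit then reduce to those of [C]. *)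
Lemma frac_opE op s c d : (forall s, {morph sigma s : c d / op c d}) ->
  frac_op op (frac s c) (frac s d) = frac s (op c d).
Proof.
move=> opM; apply/frac_eqP; rewrite !opM uactC repr_frac (uactC s) repr_frac.
by rewrite -!uact_M (mulSC (repr (frac s c)).1).
Qed.

Definition dlimD := frac_op +%R.
Definition dlimM := frac_op *%R.
Definition dlimN (x : dlim) : dlim := frac (repr x).1 (- (repr x).2).

Lemma dlimDE s c d : dlimD (frac s c) (frac s d) = frac s (c + d).
Proof. by apply: frac_opE => u; apply: raddfD. Qed.
Lemma dlimME s c d : dlimM (frac s c) (frac s d) = frac s (c * d).
Proof. by apply: frac_opE => u; apply: rmorphM. Qed.
Lemma dlimNE s c : dlimN (frac s c) = frac s (- c).
Proof. by apply/frac_eqP; rewrite !rmorphN repr_frac. Qed.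
Lemma dlim0E s : frac 1%g 0 = frac s 0.
Proof. by apply/frac_eqP; rewrite !rmorph0. Qed.
Lemma dlim1E s : frac 1%g 1 = frac s 1.
Proof. by apply/frac_eqP; rewrite !rmorph1. Qed.

Fact dlimDA : associative dlimD.
Proof.
move=> x y z; have [s [c [d [k [-> -> ->]]]]] := frac_common3 x y z.
by rewrite !dlimDE addrA.
Qed.
Fact dlimDC : commutative dlimD.
Proof.
move=> x y; have [s [c [d [-> ->]]]] := frac_common x y.
by rewrite !dlimDE addrC.
Qed.
Fact dlim0D : left_id (frac 1%g 0) dlimD.
Proof.
by move=> x; have [s [c ->]] := fracP x; rewrite (dlim0E s) dlimDE add0r.
Qed.
Fact dlimND : left_inverse (frac 1%g 0) dlimN dlimD.
Proof.
move=> x; have [s [c ->]] := fracP x.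
by rewrite (dlim0E s) dlimNE dlimDE addNr.
Qed.

HB.instance Definition _ :=
  GRing.isZmodule.Build dlim dlimDA dlimDC dlim0D dlimND.

Fact dlimMA : associative dlimM.
Proof.
move=> x y z; have [s [c [d [k [-> -> ->]]]]] := frac_common3 x y z.
by rewrite !dlimME mulrA.
Qed.
Fact dlim1M : left_id (frac 1%g 1) dlimM.
Proof.
by move=> x; have [s [c ->]] := fracP x; rewrite (dlim1E s) dlimME mul1r.
Qed.
Fact dlimM1 : right_id (frac 1%g 1) dlimM.
Proof.
by move=> x; have [s [c ->]] := fracP x; rewrite (dlim1E s) dlimME mulr1.
Qed.
Fact dlimMDl : left_distributive dlimM dlimD.
Proof.
move=> x y z; have [s [c [d [k [-> -> ->]]]]] := frac_common3 x y z.
by rewrite !(dlimDE, dlimME) mulrDl.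
Qed.
Fact dlimMDr : right_distributive dlimM dlimD.
Proof.
move=> x y z; have [s [c [d [k [-> -> ->]]]]] := frac_common3 x y z.
by rewrite !(dlimDE, dlimME) mulrDr.
Qed.

HB.instance Definition _ := GRing.Zmodule_isPzRing.Build dlim
  dlimMA dlim1M dlimM1 dlimMDl dlimMDr.

Lemma fracD s c d : frac s (c + d) = frac s c + frac s d.
Proof. by rewrite -dlimDE. Qed.
Lemma fracM s c d : frac s (c * d) = frac s c * frac s d.
Proof. by rewrite -dlimME. Qed.
Lemma fracN s c : frac s (- c) = - frac s c.
Proof. by rewrite -dlimNE. Qed.
Lemma frac1 s : frac s 1 = 1.
Proof. by rewrite -dlim1E. Qed.

End DirectLimit.

(** * Action of the group of fractions on the limit *)

Section GroupAction.
Variables (G : groupType) (P : {pred G}) (S : subMonoidType P).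
Hypothesis mulGC : forall x y : G, (x * y)%g = (y * x)%g.
Hypothesis genG : forall g : G, exists s t : S, g = ((val s)^-1 * val t)%g.

Lemma sub_mulgC (s t : S) : (s * t)%g = (t * s)%g.
Proof. by apply/val_inj; rewrite !valM mulGC. Qed.

Fact gfrac_subproof g : {st : S * S | g == ((val st.1)^-1 * val st.2)%g}.
Proof. by apply: sigW; have [s [t ->]] := genG g; exists (s, t). Qed.
Definition gnum g : S := (sval (gfrac_subproof g)).2.
Definition gden g : S := (sval (gfrac_subproof g)).1.

Lemma gfracE g : ((val (gden g))^-1 * val (gnum g))%g = g.
Proof. by rewrite /gnum /gden; case: gfrac_subproof => st /= /eqP. Qed.

Lemma gfrac_cross (s t s' t' : S) :
  ((val s)^-1 * val t = (val s')^-1 * val t' -> s * t' = s' * t)%g.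
Proof.
move=> e; apply/val_inj; rewrite !valM.
rewrite -(mulVKg (val s') (val t')) -(mulVKg (val s) (val t)) -e.
by rewrite !mulgA (mulGC (val s')).
Qed.

Variables (C : pzRingType) (sigma : unital_action S C).
Local Notation B := (dlim sigma sub_mulgC).
Local Notation frac := (frac sigma sub_mulgC).

Definition dlim_act (g : G) (x : B) : B :=
  frac (gden g * (repr x).1)%g (sigma (gnum g) (repr x).2).

(** Two fractions for [g] cross-multiply in [S], so the one chosen in [dlim_act] is immaterial, as
    is the representative of the argument. *)
Lemma dlim_actE g (s t u : S) c : ((val s)^-1 * val t)%g = g ->
  dlim_act g (frac u c) = frac (s * u)%g (sigma t c).
Proof.
rewrite -{1}(gfracE g) => /esym/gfrac_cross cross.
rewrite /dlim_act; apply/frac_eqP.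
rewrite uact_M (uactC _ sub_mulgC u) repr_frac uact_M -2!uact_M.
by rewrite (uactC _ sub_mulgC (repr _).1) -!uact_M cross.
Qed.

Fact dlim_act_additive g : zmod_morphism (dlim_act g).
Proof.
move=> x y; have [s [c [d [-> ->]]]] := frac_common x y.
by rewrite -fracN -fracD !(dlim_actE _ _ (gfracE g)) rmorphB fracD fracN.
Qed.
Fact dlim_act_multiplicative g : monoid_morphism (dlim_act g).
Proof.
split=> [|x y].
  rewrite -(frac1 sigma sub_mulgC 1%g) (dlim_actE _ _ (gfracE g)) rmorph1.
  by rewrite !frac1.
have [s [c [d [-> ->]]]] := frac_common x y.
by rewrite -fracM !(dlim_actE _ _ (gfracE g)) rmorphM fracM.
Qed.

HB.instance Definition _ g :=
  GRing.isZmodMorphism.Build B B (dlim_act g) (dlim_act_additive g).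
HB.instance Definition _ g :=
  GRing.isMonoidMorphism.Build B B (dlim_act g) (dlim_act_multiplicative g).

Fact dlim_act1 x : dlim_act 1%g x = x.
Proof.
have [u [c ->]] := fracP x.
rewrite (@dlim_actE _ 1%g 1%g) ?uact_1 ?mul1g //.
by rewrite val1 mulg1 invg1.
Qed.

Fact dlim_actM g h x : dlim_act (g * h)%g x = dlim_act g (dlim_act h x).
Proof.
have [u [c ->]] := fracP x.
rewrite (dlim_actE _ _ (gfracE h)) (dlim_actE _ _ (gfracE g)) -uact_M mulgA.
(* For g = s^-1 t and h = s'^-1 t', commutativity gives gh = (s s')^-1 (t t'). *)
apply: dlim_actE; rewrite !valM invgM -[X in _ = (X * _)%g]gfracE.
rewrite -[X in _ = (_ * X)%g]gfracE -mulgA [LHS]mulGC !mulgA -[LHS]mulgA.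
by rewrite (mulGC (val (gnum h))) mulgA.
Qed.

Definition dlim_action : group_action G B :=
  GroupAction dlim_act1 dlim_actM.

End GroupAction.

(** * Extension of the corner action to the unitization *)

Section Unitization.
Variables (S : monoidType) (A : pzRingType) (alpha : corner_action S A).

(* Under the ring isomorphism (a, n) |-> (a + n, n) of the unitization of A
   with A * int, this is the unital extension of alpha_s: it maps a + n 1 to
   alpha_s(a) + n 1. *)
Definition unitize (s : S) (c : A * int) : A * int :=
  (alpha s (c.1 - c.2%:~R) + c.2%:~R, c.2).

Lemma unitizeE s a n : unitize s (a + n%:~R, n) = (alpha s a + n%:~R, n).
Proof. by rewrite /unitize /= addrK. Qed.

(** Pairs are rewritten as a + n 1, on which [unitizeE] computes without the subtraction in
    [unitize]. *)
Lemma unitization_ind (Q : A * int -> Prop) :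
  (forall a n, Q (a + n%:~R, n)) -> forall c, Q c.
Proof. by move=> QE [a n]; rewrite -(subrK n%:~R a). Qed.

Fact unitize_additive s : zmod_morphism (unitize s).
Proof.
elim/unitization_ind=> a n; elim/unitization_ind=> b m.
have subE x y : (x + n%:~R, n) - (y + m%:~R, m)
    = (x - y + (n - m)%:~R, n - m) :> A * int.
  by congr (_, _); rewrite /= rmorphB opprD addrACA.
by rewrite !unitizeE !subE unitizeE raddfB.
Qed.

Fact unitize_multiplicative s : monoid_morphism (unitize s).
Proof.
split=> [|]; first by have:= unitizeE s 0 1; rewrite raddf0 !add0r.
elim/unitization_ind=> a n; elim/unitization_ind=> b m.
have mulE x y : (x + n%:~R, n) * (y + m%:~R, m)
    = (x * y + y *~ n + x *~ m + (n * m)%:~R, n * m) :> A * int.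
  congr (_, _); rewrite /= mulrDl !mulrDr mulrzl mulrzr rmorphM /= -!addrA.
  by congr (_ + _); rewrite addrCA.
by rewrite !unitizeE !mulE unitizeE !raddfD !raddfMz cact_mul.
Qed.

HB.instance Definition _ s :=
  GRing.isZmodMorphism.Build (A * int)%type (A * int)%type (unitize s)
    (unitize_additive s).
HB.instance Definition _ s :=
  GRing.isMonoidMorphism.Build (A * int)%type (A * int)%type (unitize s)
    (unitize_multiplicative s).

Fact unitize1 c : unitize 1%g c = c.
Proof. by case: c => a n; rewrite /unitize cact_1 /= subrK. Qed.
Fact unitizeM s t c : unitize (s * t)%g c = unitize s (unitize t c).
Proof. by rewrite /unitize /= addrK cact_M. Qed.
Fact unitize_inj s : injective (unitize s).
Proof.
by move=> [a n] [b m] [/[swap] -> /addIr/cact_inj/addIr ->].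
Qed.

Definition unitization : unital_action S (A * int)%type :=
  UnitalAction unitize1 unitizeM unitize_inj.

End Unitization.

(** * The corner of the skew group ring and the defining relations in it *)

Lemma sandwich_idem (R : pzRingType) (e x : R) :
  e * e = e -> e * (e * x * e) * e == e * x * e.
Proof. by move=> ee; rewrite !mulrA ee -!mulrA ee. Qed.

Section Dilation.
Variables (G : groupType) (P : {pred G}) (S : subMonoidType P).
Hypothesis mulGC : forall x y : G, (x * y)%g = (y * x)%g.
Hypothesis genG : forall g : G, exists s t : S, g = ((val s)^-1 * val t)%g.
Variables (A : pzRingType) (alpha : corner_action S A).

Local Notation sigma := (unitization alpha).
Local Notation B := (dlim sigma (sub_mulgC mulGC)).
Local Notation frac := (frac sigma (sub_mulgC mulGC)).
Local Notation ahat := (dlim_action mulGC genG sigma).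

(** In the product coordinates on the unitization, the ideal [A] consists of the pairs with second
    entry 0. The image of 1 is the idempotent e, not 1. *)
Definition emb (a : A) : B := frac 1%g (a, 0).
Definition dilation_unit : B := emb 1.
Local Notation e := dilation_unit.

Lemma embB a b : emb (a - b) = emb a - emb b.
Proof. by rewrite /emb -fracN -fracD; congr frac; rewrite /= subr0. Qed.

Lemma embM a b : emb (a * b) = emb a * emb b.
Proof. by rewrite /emb -fracM; congr frac; rewrite /= mulr0. Qed.

Lemma unit_emb a : e * emb a = emb a.
Proof. by rewrite -embM mul1r. Qed.
Lemma emb_unit a : emb a * e = emb a.
Proof. by rewrite -embM mulr1. Qed.

Lemma dilation_unit_idem : e * e = e.
Proof. exact: unit_emb. Qed.

Lemma unitization_emb s (a : A) : sigma s (a, 0) = (alpha s a, 0).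
Proof. by rewrite /= /unitize /= subr0 addr0. Qed.

Lemma ahat_emb (s : S) a : ahat (val s) (emb a) = emb (alpha s a).
Proof.
rewrite /= (@dlim_actE _ _ _ _ genG _ _ _ 1%g s) ?mulg1 ?unitization_emb //.
by rewrite val1 invg1 mul1g.
Qed.

Lemma ahatVK (s : S) : cancel (ahat (val s)) (ahat (val s)^-1%g).
Proof. by move=> b; rewrite -gact_M mulVg gact_1. Qed.
Lemma ahatKV (s : S) : cancel (ahat (val s)^-1%g) (ahat (val s)).
Proof. by move=> b; rewrite -gact_M mulgV gact_1. Qed.

Lemma ahatV_frac (s : S) c : ahat (val s)^-1%g (frac 1%g c) = frac s c.
Proof.
rewrite /= (@dlim_actE _ _ _ _ genG _ _ _ s 1%g) ?mulg1 ?uact_1 //.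
by rewrite val1 mulg1.
Qed.

Lemma ahat_unit_le (s : S) : idem_le (ahat (val s) e) e.
Proof. by rewrite ahat_emb; split; [apply: unit_emb | apply: emb_unit]. Qed.

(** Applying s to both sides turns this into [ahat_unit_le]. It absorbs the factors s^-1.e that
    arise when elements of the corner are multiplied. *)
Lemma unit_leV (s : S) : idem_le e (ahat (val s)^-1%g e).
Proof.
have [le1 le2] := ahat_unit_le s.
by split; apply: (can_inj (ahatVK s)); rewrite rmorphM ahatKV.
Qed.

Lemma unit_ahatV_emb (s : S) a :
  e * ahat (val s)^-1%g (emb a) = ahat (val s)^-1%g (emb (alpha s 1 * a)).
Proof. by rewrite embM rmorphM -ahat_emb ahatVK. Qed.

(** [A] is an ideal of the unitization: for b = s^-1.c one has e b = s^-1.((s.e) c), and s.e comes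
    from [A], hence so does the numerator. *)
Lemma unit_mul b : exists (s : S) a, e * b = e * ahat (val s)^-1%g (emb a).
Proof.
have [s [[c n] ->]] := fracP b; exists s, (alpha s 1 * c).
rewrite -ahatV_frac -{1}dilation_unit_idem -mulrA; congr (e * _).
rewrite -[e in LHS](ahatVK s) -rmorphM ahat_emb /emb -fracM.
by congr (ahat _ (frac _ (_, _))); apply: mul0r.
Qed.

(** The coefficient of the image of s_- phi(a) t_+ as a single fraction. It uses e = s^-1.(s.e) and
    g.e = s^-1.(t.e), where s.e and t.e are the images of p_s and p_t. *)
Lemma ahat_frac_emb g (s t : S) a : ((val s)^-1 * val t)%g = g ->
  e * ahat (val s)^-1%g (emb a) * ahat g e
    = frac s (alpha s 1 * a * alpha t 1, 0).
Proof.
move=> <-; rewrite unit_ahatV_emb gact_M ahat_emb -rmorphM -embM.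
exact: ahatV_frac.
Qed.

Local Notation e1 := (skew_const ahat e).
Local Notation eBGe := (corner (skew_const_idem ahat dilation_unit_idem)).

Lemma skew_monom_cornerE b g :
  e1 * skew_monom ahat b g * e1 = skew_monom ahat (e * b * ahat g e) g.
Proof. by rewrite !skew_monomM gact_1 mul1g mulg1. Qed.

Fact corner_monom_subproof b g :
  e1 * (e1 * skew_monom ahat b g * e1) * e1 == e1 * skew_monom ahat b g * e1.
Proof. exact/sandwich_idem/skew_const_idem/dilation_unit_idem. Qed.
Definition corner_monom b g : eBGe :=
  Corner (skew_const_idem ahat dilation_unit_idem) (corner_monom_subproof b g).

Lemma corner_monom_component b g : corner_skew_component g (corner_monom b g).
Proof. by exists b. Qed.

Lemma val_corner_monom b g :
  val (corner_monom b g) = skew_monom ahat (e * b * ahat g e) g.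
Proof. exact: skew_monom_cornerE. Qed.

Lemma corner_monom_eq b c g :
  e * b * ahat g e = e * c * ahat g e -> corner_monom b g = corner_monom c g.
Proof. by move=> bc; apply/val_inj; rewrite !val_corner_monom bc. Qed.

Lemma corner_monomM b c g h : corner_monom b g * corner_monom c h
  = corner_monom (b * ahat g (e * c)) (g * h)%g.
Proof.
apply/val_inj; rewrite [LHS]val_cornerM !val_corner_monom skew_monomM.
congr skew_monom; rewrite !rmorphM -gact_M !mulrA.
by rewrite -[_ * ahat g e * ahat g e]mulrA -rmorphM dilation_unit_idem.
Qed.

Definition dil_phi a : eBGe := corner_monom (emb a) 1%g.
Definition dil_m (s : S) : eBGe := corner_monom e (val s)^-1%g.
Definition dil_p (s : S) : eBGe := corner_monom e (val s).

Lemma val_dil_phi a : val (dil_phi a) = skew_monom ahat (emb a) 1%g.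
Proof. by rewrite val_corner_monom gact_1 unit_emb emb_unit. Qed.

Fact dil_phi_additive : zmod_morphism dil_phi.
Proof.
move=> a b; apply/val_inj.
rewrite [RHS](_ : _ = val (dil_phi a) - val (dil_phi b)) //.
by rewrite !val_dil_phi embB; apply: monalgUB.
Qed.
Fact dil_phi_multiplicative : monoid_morphism dil_phi.
Proof.
split=> [|a b]; apply/val_inj; rewrite ?val_cornerM !val_dil_phi //.
by rewrite skew_monomM gact_1 embM mulg1.
Qed.

HB.instance Definition _ :=
  GRing.isZmodMorphism.Build A eBGe dil_phi dil_phi_additive.
HB.instance Definition _ :=
  GRing.isMonoidMorphism.Build A eBGe dil_phi dil_phi_multiplicative.

Lemma dil_rep : skew_rep alpha dil_phi dil_m dil_p.
Proof.
have ee := dilation_unit_idem.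
have geV (s : S) := proj2 (unit_leV s).
have corner1E : corner_monom e 1%g = 1.
  by apply/val_inj; rewrite val_corner_monom gact_1 !ee.
split; rewrite /dil_m /dil_p ?val1 ?invg1 //=.
- by move=> s u; rewrite corner_monomM ee geV valM invgM.
(* The inner e leaves a factor t.e, which is absorbed since (tu).e <= t.e. *)
- move=> t u; rewrite valM corner_monomM ee; apply: corner_monom_eq.
  by rewrite gact_M !ahat_emb ee !unit_emb -embM -cact_mul mul1r.
- move=> t a; rewrite !corner_monomM gact_1 unit_emb ahat_emb ee mul1g mulg1.
  by apply: corner_monom_eq; rewrite !unit_emb emb_unit unit_emb.
- move=> s a; rewrite !corner_monomM gact_1 ee mul1g mulg1.
  apply: corner_monom_eq.
  by rewrite emb_unit !unit_emb -ahat_emb ahatVK !unit_emb.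
- by move=> s; rewrite corner_monomM ee mulVg -corner1E geV.
- by move=> s; rewrite corner_monomM ee mulgV ahat_emb unit_emb.
Qed.

Lemma dil_monomE (s t : S) a :
  dil_m s * dil_phi a * dil_p t
    = corner_monom (ahat (val s)^-1%g (emb a)) ((val s)^-1 * val t)%g.
Proof.
have ee := dilation_unit_idem.
rewrite !corner_monomM mulg1 ee; apply: corner_monom_eq.
congr (_ * _).
by rewrite unit_emb -(mulrA e) -rmorphM emb_unit mulrA ee.
Qed.

(** By [unit_mul] the coefficient may be taken to be u^-1.a with a in [A]. Writing g = s^-1 t as
    (su)^-1 (tu) and u^-1.a as (su)^-1.alpha_s(a) gives both the same denominator. *)
Lemma corner_monom_dilE b g : exists (s t : S) a,
  ((val s)^-1 * val t)%g = g
  /\ corner_monom b g = dil_m s * dil_phi a * dil_p t.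
Proof.
have [u [a ba]] := unit_mul b.
pose s := gden genG g; pose t := gnum genG g.
have gE : ((val (s * u)%g)^-1 * val (t * u)%g)%g = g.
  rewrite !valM invgM -[RHS](gfracE genG) -/s -/t [RHS]mulGC [LHS]mulGC.
  by rewrite mulgA -[(_ * val u * _)%g]mulgA mulgV mulg1.
exists (s * u)%g, (t * u)%g, (alpha s a); split=> //.
rewrite dil_monomE gE; apply: corner_monom_eq; rewrite ba -ahat_emb.
by rewrite valM invgM gact_M ahatVK.
Qed.

End Dilation.

(** * Spanning of R by the elements s_- phi(a) t_+ *)

Section Spanning.
Variables (S : monoidType) (A : pzRingType) (alpha : corner_action S A).
Hypothesis mulSC : forall s t : S, (s * t)%g = (t * s)%g.
Variables (R : pzRingType) (phi : {rmorphism A -> R}) (sm sp : S -> R).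

Inductive monom_span : R -> Prop :=
| span_monom s a t : monom_span (sm s * phi a * sp t)
| span_add x y : monom_span x -> monom_span y -> monom_span (x + y).

Hypothesis rep : skew_rep alpha phi sm sp.

Lemma sm_comm s t : sm s * sm t = sm t * sm s.
Proof. by rewrite -!(sm_M rep) mulSC. Qed.
Lemma sp_comm s t : sp s * sp t = sp t * sp s.
Proof. by rewrite -!(sp_M rep) mulSC. Qed.

(** Insert s_- s_+ = 1 on the left, exchange s_+ and t_+, and move s_+ s_- = phi(p_s) past t_+. *)
Lemma sp_sm_comm t s : sp t * sm s = sm s * phi (alpha t (alpha s 1)) * sp t.
Proof.
rewrite -[LHS]mul1r -(sm_sp rep s) -!mulrA [sp s * _]mulrA sp_comm -mulrA.
by rewrite (sp_sm rep) (sp_phi rep).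
Qed.

Lemma span0 : monom_span 0.
Proof. by have := span_monom 1%g 0 1%g; rewrite rmorph0 mulr0 mul0r. Qed.

Lemma spanN x : monom_span x -> monom_span (- x).
Proof.
elim=> [s a t|y z _ IHy _ IHz]; last by rewrite opprD; apply: span_add.
by rewrite -mulNr -mulrN -rmorphN; apply: span_monom.
Qed.

(** Induction on the term: left multiplication by each generator phi(b), u_-, u_+ sends monomials to
    monomials. *)
Lemma span_teval w x : monom_span x -> monom_span (teval phi sm sp w * x).
Proof.
have ext (z : R) : (forall s a t, monom_span (z * (sm s * phi a * sp t))) ->
    forall y, monom_span y -> monom_span (z * y).
  by move=> zM y; elim=> // y1 y2 _ IH1 _ IH2; rewrite mulrDr; apply: span_add.
elim: w x => [b|u|u|||w IHw|w IHw v IHv|w IHw v IHv] /= x.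
- apply: ext => s a t; rewrite !mulrA (phi_sm rep) -[_ * phi a]mulrA -rmorphM.
  exact: span_monom.
- apply: ext => s a t; rewrite !mulrA -(sm_M rep); exact: span_monom.
- apply: ext => s a t; rewrite !mulrA sp_sm_comm -[_ * phi a]mulrA (sp_phi rep).
  rewrite mulrA -[_ * phi _ * phi _]mulrA -rmorphM -mulrA -(sp_M rep).
  exact: span_monom.
- by move=> _; rewrite mul0r; apply: span0.
- by rewrite mul1r.
- by move=> Vx; rewrite mulNr; apply/spanN/IHw.
- by move=> Vx; rewrite mulrDl; apply: span_add; [apply: IHw | apply: IHv].
- by move=> Vx; rewrite -mulrA; apply/IHw/IHv.
Qed.

(** The universal property maps R to the term model [fsmr], and by uniqueness the composite R ->
    [fsmr] -> R is the identity. So each x is the value of a term, and [span_teval] is applied to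
    1. *)
Lemma fractional_span : is_fractional_skew_monoid_ring alpha phi sm sp ->
  forall x, monom_span x.
Proof.
move=> [_ univ] x; have [h2 [h2phi h2m h2p] _] := univ _ _ _ _ (fsmr_rep alpha).
have [h _ h_uniq] := univ _ _ _ _ rep.
have xE : lift_of rep (h2 x) = x.
  rewrite -[RHS]/(idfun x) [RHS]h_uniq; last by split.
  rewrite -[LHS]/((lift_of rep \o h2) x) [LHS]h_uniq //.
  by split=> y /=; rewrite ?h2phi ?h2m ?h2p fsmr_liftE.
rewrite -xE -[lift_of _ _]mulr1; apply: span_teval.
by have := span_monom 1%g 1 1%g; rewrite rmorph1 (sm_1 rep) (sp_1 rep) !mulr1.
Qed.

End Spanning.

(** * An additive left inverse, defined on the whole skew group ring *)

Section LeftInverse.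
Variables (G : groupType) (P : {pred G}) (S : subMonoidType P).
Hypothesis mulGC : forall x y : G, (x * y)%g = (y * x)%g.
Hypothesis genG : forall g : G, exists s t : S, g = ((val s)^-1 * val t)%g.
Variables (A : pzRingType) (alpha : corner_action S A).
Variables (R : pzRingType) (phi : {rmorphism A -> R}) (sm sp : S -> R).
Hypothesis rep : skew_rep alpha phi sm sp.

Local Notation sigma := (unitization alpha).
Local Notation B := (dlim sigma (sub_mulgC mulGC)).
Local Notation frac := (frac sigma (sub_mulgC mulGC)).
Local Notation ahat := (dlim_action mulGC genG sigma).
Local Notation SR := (skew_group_ring ahat).
Let smC := sm_comm (sub_mulgC mulGC) rep.
Let spC := sp_comm (sub_mulgC mulGC) rep.

Definition rho (g : G) : R := sm (gden genG g) * sp (gnum genG g).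

(** Let s', t' be the fraction chosen for [g]. Inserting s_- s_+ = 1 and using s t' = s' t turns
    s'_- t'_+ into s_- s'_- s'_+ t_+ = s_- t_+. *)
Lemma rhoE g (s t : S) : ((val s)^-1 * val t)%g = g -> rho g = sm s * sp t.
Proof.
rewrite -{1}(gfracE genG g) => /(gfrac_cross mulGC) cross; rewrite /rho.
set s' := gden _ _ in cross *; set t' := gnum _ _ in cross *.
rewrite -[sp t']mul1r -(sm_sp rep s) -[sm s * _ * _]mulrA -(sp_M rep) cross.
by rewrite (sp_M rep) !mulrA smC -[sm s * _ * _]mulrA (sm_sp rep) mulr1.
Qed.

Lemma sm_rho_sp g u : sm u * rho g * sp u = rho g.
Proof.
by rewrite /rho mulrA smC -2!mulrA spC [sm u * _]mulrA (sm_sp rep) mul1r.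
Qed.

(* The inverse of R_g -> e(Bg)e, extended additively to all of B by projecting
   the unitization onto A. The factors come from (u^-1.c) g = u^-1 c g u, which
   holds in B * G because G is abelian. *)
Definition comp_val (g : G) (u : S) (c : A * int) : R :=
  sm u * phi (c.1 - c.2%:~R) * rho g * sp u.

(** From v_- phi(alpha_v(a)) = phi(a) v_- and [sm_rho_sp]. This makes [comp_val] well defined on
    fractions. *)
Lemma comp_val_scale g v u c :
  comp_val g (v * u)%g (sigma v c) = comp_val g u c.
Proof.
rewrite /comp_val /= /unitize addrK (sm_M rep) (sp_M rep) -[_ * phi _]mulrA.
rewrite -(phi_sm rep) [LHS]mulrA; congr (_ * _).
move: (rho g) (sm_rho_sp g v) => r rE.
by rewrite -!mulrA (mulrA (sm v) r) rE.
Qed.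

Definition comp_inv (g : G) (x : B) : R := comp_val g (repr x).1 (repr x).2.

Lemma comp_inv_frac g u c : comp_inv g (frac u c) = comp_val g u c.
Proof.
rewrite /comp_inv -(comp_val_scale g u) repr_frac (sub_mulgC mulGC).
exact: comp_val_scale.
Qed.

Lemma comp_invD g : {morph comp_inv g : x y / x + y}.
Proof.
move=> x y; have [s [c [d [-> ->]]]] := frac_common x y.
rewrite -fracD !comp_inv_frac /comp_val /= intrD opprD addrACA.
by rewrite rmorphD mulrDr !mulrDl.
Qed.

Lemma comp_inv0 g : comp_inv g 0 = 0.
Proof. by apply: (addrI (comp_inv g 0)); rewrite -comp_invD !addr0. Qed.

(** The idempotents are absorbed by s_- phi(p_s) = s_- and phi(p_t) t_+ = t_+, and the outer s_+
    cancels through s_- t_+ s_+ = t_+. *)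
Lemma comp_inv_monom g (s t : S) a : ((val s)^-1 * val t)%g = g ->
  comp_inv g (frac s (alpha s 1 * a * alpha t 1, 0)) = sm s * phi a * sp t.
Proof.
move=> gE; rewrite comp_inv_frac /comp_val /= subr0 (rhoE gE) !rmorphM !mulrA.
rewrite -(phi_sm rep) rmorph1 mul1r -!mulrA; congr (_ * (_ * _)).
rewrite spC [sm s * _]mulrA (sm_sp rep) mul1r.
by rewrite -(sp_phi rep) rmorph1 mulr1.
Qed.

Definition skew_inv (x : SR) : R := \sum_(g <- msupp x) comp_inv g x@_g.

Lemma skew_invw (d : {fset G}) (x : SR) : (msupp x `<=` d)%fset ->
  skew_inv x = \sum_(g <- d) comp_inv g x@_g.
Proof.
move=> le; apply: big_fset_incl => // g _ /mcoeff_outdom ->.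
exact: comp_inv0.
Qed.

Lemma skew_invD : {morph skew_inv : x y / x + y}.
Proof.
move=> x y; rewrite (skew_invw (msuppD_le x y)).
rewrite (skew_invw (fsubsetUl (msupp x) (msupp y))).
rewrite (skew_invw (fsubsetUr (msupp x) (msupp y))) -big_split.
by apply: eq_bigr => g _; rewrite mcoeffD comp_invD.
Qed.

Lemma skew_inv_monom b g : skew_inv (skew_monom ahat b g) = comp_inv g b.
Proof. by rewrite (skew_invw msuppU_le) big_seq_fset1 mcoeffUU. Qed.

End LeftInverse.

(** * The graded isomorphism *)

Lemma skew_corner_ind (G : groupType) (B : pzRingType)
    (ahat : group_action G B) (e : B) (idem_e : e * e = e)
    (Q : corner (skew_const_idem ahat idem_e) -> Prop) :
  (forall x y, Q x -> Q y -> Q (x + y)) ->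
  (forall g z, corner_skew_component g z -> Q z) -> forall z, Q z.
Proof.
move=> QD QM z; have: val z = skew_const ahat e * val z * skew_const ahat e.
  by rewrite cornerE.
(* Only the inner [val z] is generalized, to any [w] in the skew group ring: the summands of [w]
   need not lie in the corner, but their compressions by e do. *)
move: {2}(val z) => w; elim/skew_ind: w z => [|w w' IHw IHw'|b g] z zE.
- by apply: (QM 1%g); exists 0; rewrite skew_monom0.
- pose E := skew_const_idem ahat idem_e.
  have [|x xE] := (cornerP E (skew_const ahat e * w * skew_const ahat e)).1.
    by exists w.
  have [|y yE] := (cornerP E (skew_const ahat e * w' * skew_const ahat e)).1.
    by exists w'.
  have -> : z = x + y.
    by apply/val_inj; rewrite zE val_cornerD xE yE mulrDr mulrDl.
  by apply: QD; [apply: IHw | apply: IHw'].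
- by apply: (QM g); exists b.
Qed.

Theorem proposition3p8 (A : pzRingType)
    (G : groupType) (mulGC : forall x y : G, (x * y)%g = (y * x)%g)
    (P : {pred G}) (S : subMonoidType P)
    (genG : forall g : G, exists s t : S, g = ((val s)^-1 * val t)%g)
    (alpha : corner_action S A)
    (R : pzRingType) (phi : {rmorphism A -> R}) (sm sp : S -> R)
    (univR : is_fractional_skew_monoid_ring alpha phi sm sp) :
  exists (B : pzRingType) (ahat : group_action G B) (e : B) (idem_e : e * e = e),
    (forall s : S, idem_le (ahat (val s) e) e) /\
    graded_isomorphic (fsmr_component phi sm sp)
      (corner_skew_component (ahat := ahat) (idem_e := idem_e)).
Proof.
have rep := proj1 univR.
exists (dlim (unitization alpha) (sub_mulgC mulGC)).
exists (dlim_action mulGC genG (unitization alpha)).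
exists (dilation_unit mulGC alpha), (dilation_unit_idem mulGC alpha).
split; first exact: ahat_unit_le.
have [f [fphi fm fp] _] := proj2 univR _ _ _ _ (dil_rep mulGC genG alpha).
pose ahat := dlim_action mulGC genG (unitization alpha).
have f_monom s a t : f (sm s * phi a * sp t)
    = corner_monom genG (ahat (val s)^-1%g (emb mulGC alpha a))
        ((val s)^-1 * val t)%g.
  by rewrite !rmorphM fphi fm fp dil_monomE.
pose h (z : corner (skew_const_idem ahat (dilation_unit_idem mulGC alpha))) :=
  skew_inv phi sm sp (val z).
(* Both maps are additive, so it is enough to check the monomials, which span R. *)
have fK : cancel f h.
  move=> x; have := fractional_span (sub_mulgC mulGC) rep univR x.
  elim=> [s a t|y z _ IHy _ IHz].
    rewrite f_monom /h val_corner_monom (skew_inv_monom _ rep).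
    rewrite (ahat_frac_emb mulGC genG alpha a (erefl _)).
    by rewrite (comp_inv_monom _ _ rep).
  by rewrite /h (rmorphD f) val_cornerD (skew_invD rep) -/(h _) -/(h _) IHy IHz.
(* Lifting within a fixed degree gives surjectivity and, once [f] is injective, shows that [f]
   reflects degrees. *)
have f_comp g z : corner_skew_component g z ->
    exists2 x, fsmr_component phi sm sp g x & f x = z.
  move=> [b zE]; have [s [t [a [gE E]]]] := corner_monom_dilE genG b g.
  exists (sm s * phi a * sp t); first by exists s, t, a.
  rewrite f_monom -dil_monomE -E; apply/val_inj; exact: esym zE.
have f_surj z : exists x, f x = z.
  elim/skew_corner_ind: z => [_ _ [x <-] [y <-]|g z /f_comp [x _ <-]].
    by exists (x + y); rewrite (rmorphD f).
  by exists x.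
exists f; split.
  by apply: (Bijective fK) => z; have [x <-] := f_surj z; rewrite fK.
move=> g x; split=> [[s [t [a [<- ->]]]]|/f_comp [y gy /(can_inj fK) <-] //].
by rewrite f_monom; apply: corner_monom_component.
Qed.
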